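(* Let $\Gamma$ be an $R$-thin connected graph and $k\geq 2$ an integer. If for every $\{u,v\}\in E(\Gamma^* )$ the set $N_{\Gamma}(u)\cap N_{\Gamma}(v)$ is not an independent set of $\Gamma$, then $(\Gamma, C_{2k+1})$ is stable.
   Context: All graphs are finite and undirected with no loops or parallel edges. $V(\Gamma)$, $E(\Gamma)$ are the vertex and edge sets, $N_\Gamma(u)$ is the neighbourhood of $u$, $\deg(u)=|N_\Gamma(u)|$, $\mathrm{Aut}(\Gamma)$ is the automorphism group, and $C_n$ is the cycle with $n\ge 3$ vertices. The direct product $\Gamma \times \Sigma$ has vertex set $V(\Gamma) \times V(\Sigma)$, with $(u,v)$ and $(x,y)$ adjacent if and only if $\{u,x\}\in E(\Gamma)$ and $\{v,y\}\in E(\Sigma)$. A graph $\Gamma$ is $R$-thin if $N_\Gamma(u) \ne N_\Gamma(v)$ for any two distinct vertices $u,v$. A graph pair $(\Gamma,\Sigma)$ is stable if $\mathrm{Aut}(\Gamma)\times\mathrm{Aut}(\Sigma)$ is isomorphic to $\mathrm{Aut}(\Gamma\times\Sigma)$. $\Gamma^*$ is the graph with vertex set $V(\Gamma)$ in which $u,v$ are adjacent if and only if $u \ne v$ and $\deg(u)=\deg(v)=2|N_\Gamma(u)\cap N_\Gamma(v)|$ (degrees in $\Gamma$).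
   Formalization: Γ is assumed to have at least two vertices; the claim fails for K_1, since K_1 × C_{2k+1} is edgeless with automorphism group S_{2k+1}, not the dihedral group Aut(C_{2k+1}), and it fails for the empty graph. *)

(* Defs.v *)
From HB Require Import structures.
From mathcomp Require Import all_boot all_fingroup.

Set Implicit Arguments.
Unset Strict Implicit.
Unset Printing Implicit Defensive.

Record sgraph := SGraph {
  vertex :> finType;
  adj : rel vertex;
  adj_sym : symmetric adj;
  adj_irrefl : irreflexive adj
}.

Section Graph.
Variable G : sgraph.
Implicit Types (u v : G) (A : {set G}).

Definition nbh u : {set G} := [set v | adj u v].

Definition deg u : nat := #|nbh u|.

Definition connected : Prop := forall u v, connect (@adj G) u v.

Definition R_thin : Prop := forall u v, u != v -> nbh u != nbh v.

Definition independent A : bool :=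
  [forall u in A, forall v in A, ~~ adj u v].

(* [Aut] is taken by the automorphism group of a finite group in MathComp. *)
Definition graph_aut : {set {perm G}} :=
  [set s : {perm G} | [forall u, forall v, adj (s u) (s v) == adj u v]].

Lemma graph_autP (s : {perm G}) :
  reflect (forall u v, adj (s u) (s v) = adj u v) (s \in graph_aut).
Proof.
rewrite inE; apply: (iffP idP) => [/forallP h u v | h].
  by apply/eqP; move/forallP: (h u); apply.
by apply/forallP => u; apply/forallP => v; rewrite h.
Qed.

Lemma graph_aut_group_set : group_set graph_aut.
Proof.
apply/group_setP; split=> [|s t /graph_autP hs /graph_autP ht].
  by apply/graph_autP => u v; rewrite !perm1.
by apply/graph_autP => u v; rewrite !permM ht hs.
Qed.

Canonical graph_aut_group := Group graph_aut_group_set.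

Definition star_adj : rel G := fun u v =>
  [&& u != v, deg u == deg v & deg v == 2 * #|nbh u :&: nbh v|].

Lemma star_adj_sym : symmetric star_adj.
Proof.
move=> u v; rewrite /star_adj [v == u]eq_sym [deg v == deg u]eq_sym setIC.
by case: (u =P v) => //= _; case: (deg u =P deg v) => //= ->.
Qed.

Lemma star_adj_irrefl : irreflexive star_adj.
Proof. by move=> u; rewrite /star_adj eqxx. Qed.

(* The graph written Gamma^* for G = Gamma. *)
Definition star : sgraph := SGraph star_adj_sym star_adj_irrefl.

End Graph.

Section DirectProduct.
Variables G H : sgraph.

Definition dprod_adj : rel (G * H)%type :=
  fun p q => adj p.1 q.1 && adj p.2 q.2.

Lemma dprod_adj_sym : symmetric dprod_adj.
Proof. by move=> p q; rewrite /dprod_adj [adj p.1 _]adj_sym [adj p.2 _]adj_sym. Qed.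

Lemma dprod_adj_irrefl : irreflexive dprod_adj.
Proof. by move=> p; rewrite /dprod_adj adj_irrefl. Qed.

Definition direct_product : sgraph := SGraph dprod_adj_sym dprod_adj_irrefl.

Definition stable : Prop :=
  setX (graph_aut G) (graph_aut H) \isog graph_aut direct_product.

End DirectProduct.

Section Cycle.
Variable n : nat.

(* [ordS i] is i + 1 modulo n.  The conjunct [i != j] only matters for n = 1,
   and this is the cycle C_n when n >= 3. *)
Definition cycle_adj : rel 'I_n :=
  fun i j => (i != j) && ((j == ordS i) || (i == ordS j)).

Lemma cycle_adj_sym : symmetric cycle_adj.
Proof. by move=> i j; rewrite /cycle_adj eq_sym orbC. Qed.

Lemma cycle_adj_irrefl : irreflexive cycle_adj.
Proof. by move=> i; rewrite /cycle_adj eqxx. Qed.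

Definition cycle_graph : sgraph := SGraph cycle_adj_sym cycle_adj_irrefl.

End Cycle.

(* Main.v *)
Require Import Defs.
From HB Require Import structures.
From mathcomp Require Import all_boot all_fingroup.
From mathcomp Require Import all_algebra.
From mathcomp Require Import ring zify.

Set Implicit Arguments.
Unset Strict Implicit.
Unset Printing Implicit Defensive.

Import Defs GRing.Theory.

(** Write P for the direct product of G with an odd cycle C_n, n >= 5.  The
    graph P^* can be computed exactly ([star_adj_dprod_cycle]): since two
    vertices of C_n share 2, 1 or 0 neighbours according as they are equal, at
    distance 2, or neither, and since G is R-thin, an edge of P^* either joins
    (u, i) to (u, i +- 2), or joins (u, i) to (v, i) for an edge {u, v} of G^*.
    As n is odd, the edges of the first kind link up each fibre {u} x C_n.

    Automorphisms of P preserve P^*; the point is that they also preserve the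
    kind of an edge ([fibre_stepP]).  The common neighbours of (u, i) and
    (u, i + 2) all lie over the single vertex i + 1, so an odd walk between two
    of them projects to a closed odd walk of C_n and has length at least n.  For
    an edge of the second kind, the hypothesis gives adjacent common neighbours
    w and z of u and v; going back and forth along {w, z} while walking from
    i + 1 to i - 1 the long way round C_n is a walk of odd length n - 2 between
    the common neighbours (w, i + 1) and (z, i - 1).

    Hence an automorphism of P permutes the fibres: it has the form
    (u, i) |-> (alpha u, phi_u i).  Each phi_u is injective and preserves
    differences +-2, so it is i |-> a + e i with e = +-1 ([step2_affine]).  If u
    and v are adjacent, phi_v maps the neighbours of i to those of phi_u i, and
    these are also the neighbours of phi_v i; so phi_u = phi_v, as C_n is
    R-thin.  By connectedness all phi_u coincide, and the automorphism is a
    product of one of G and one of C_n ([aut_factorization]).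

    The cycle is handled in the ring Z/n, realised on 'I_m.+2 with n = m + 2. *)

(** * Walks and automorphisms *)

Section Walks.

Fixpoint walk (G : sgraph) (m : nat) (x y : G) : Prop :=
  if m is l.+1 then exists2 z, adj x z & walk l z y else x = y.

Lemma walk_dprod (G H : sgraph) m (p q : direct_product G H) :
  walk m p q <-> walk m p.1 q.1 /\ walk m p.2 q.2.
Proof.
case: q => v j; elim: m p => [|m IH] [u i] /=.
  by split=> [[-> ->] | [-> ->]].
split=> [[[w l] /andP[/= uw il]] /IH[/= wv lj] | [[w uw wv] [l il lj]]].
  by split; [exists w | exists l].
by exists (w, l); [rewrite /= /dprod_adj /= uw | apply/IH].
Qed.

(** Going back and forth along one edge gives walks of every length. *)
Lemma walk_edge (G : sgraph) m (w z : G) :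
  adj w z -> walk m w (if odd m then z else w).
Proof.
elim: m w z => [|m IH] w z wz //=.
have zw : adj z w by rewrite adj_sym.
by exists z => //; have := IH _ _ zw; case: (odd m).
Qed.

Lemma walk_aut (G : sgraph) (s : {perm G}) m x y :
  s \in graph_aut G -> walk m (s x) (s y) <-> walk m x y.
Proof.
move/graph_autP=> hs; elim: m x => [|m IH] x /=.
  by split=> [/perm_inj | ->].
split=> [[z xz zy] | [z xz zy]].
  exists ((s^-1)%g z); first by rewrite -hs permKV.
  by apply/IH; rewrite permKV.
by exists (s z); rewrite ?hs //; apply/IH.
Qed.

End Walks.

Section Automorphisms.

Variables (G : sgraph) (s : {perm G}).
Hypothesis hs : s \in graph_aut G.

Lemma nbh_aut u : nbh (s u) = s @: nbh u.
Proof.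
apply/setP=> v; rewrite -[v](permKV s) mem_imset; last exact: perm_inj.
by rewrite !inE (graph_autP _ hs).
Qed.

Lemma star_adj_aut u v : star_adj (s u) (s v) = star_adj u v.
Proof.
rewrite /star_adj /deg !nbh_aut (inj_eq perm_inj) -imsetI; last first.
  by move=> ? ? _ _; apply: perm_inj.
by rewrite !card_imset //; apply: perm_inj.
Qed.

Lemma mem_common_nbh_aut u v x :
  (s x \in nbh (s u) :&: nbh (s v)) = (x \in nbh u :&: nbh v).
Proof. by rewrite !inE !(graph_autP _ hs). Qed.

End Automorphisms.

(** * Products of automorphisms *)

Section Product.

Variables G H : sgraph.
Local Notation P := (direct_product G H).

Lemma nbh_dprod (p : P) : nbh p = setX (nbh p.1) (nbh p.2).
Proof. by apply/setP=> q; rewrite !inE. Qed.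

Lemma common_nbh_dprod (p q : P) :
  nbh p :&: nbh q = setX (nbh p.1 :&: nbh q.1) (nbh p.2 :&: nbh q.2).
Proof. by apply/setP=> r; rewrite !nbh_dprod !inE andbACA. Qed.

Definition pair_fun (a : {perm G} * {perm H}) (p : P) : P := (a.1 p.1, a.2 p.2).

Lemma pair_fun_inj a : injective (pair_fun a).
Proof. by move=> [u i] [v j] [/perm_inj-> /perm_inj->]. Qed.

Definition pair_perm a : {perm P} := perm (@pair_fun_inj a).

Lemma pair_permE a u i : pair_perm a (u, i) = (a.1 u, a.2 i).
Proof. by rewrite permE. Qed.

Lemma pair_permM :
  {in setX (graph_aut G) (graph_aut H) &, {morph pair_perm : a b / (a * b)%g}}.
Proof.
move=> a b _ _; apply/permP => -[u i].
by rewrite permM !pair_permE /= !permM.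
Qed.

(** Both graphs must be nonempty for a product of automorphisms to determine
    its factors; [u0] and [i0] witness this. *)
Lemma stable_of_factorization (u0 : G) (i0 : H) :
    (forall s : {perm P}, s \in graph_aut P ->
      exists2 a, a \in setX (graph_aut G) (graph_aut H) & s = pair_perm a) ->
  stable G H.
Proof.
move=> factor; apply/isogP; exists (Morphism pair_permM).
  apply/injmP=> a b _ _ /= /permP eab.
  case: a b eab => [a a'] [b b'] eab; congr (_, _); apply/permP.
    by move=> u; have := eab (u, i0); rewrite !pair_permE => -[].
  by move=> i; have := eab (u0, i); rewrite !pair_permE => -[].
apply/setP=> s; apply/morphimP/idP.
  case=> -[a a'] _ /setXP[/graph_autP ha /graph_autP ha'] ->.
  by apply/graph_autP => -[u i] [v j]; rewrite /= !pair_permE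
    /= /dprod_adj /= ha ha'.
by move=> /factor[a aA ->]; exists a.
Qed.

End Product.

(** * Odd cycles *)

Section OddCycle.

Variable m : nat.
Hypotheses (m_odd : odd m) (m_gt2 : 2 < m).
Local Notation C := (cycle_graph m.+2).
Local Notation Z := 'I_m.+2.
Local Open Scope ring_scope.

Lemma ord_natr_eq0 l : ((l%:R : Z) == 0) = (m.+2 %| l)%N.
Proof. by rewrite -val_eqE /= Zp_nat /=. Qed.

Lemma ord_n_eq0 : (m.+2)%:R = 0 :> Z.
Proof. by apply/eqP; rewrite ord_natr_eq0. Qed.

(** Multiples of 2 exhaust Z/n because n is odd: (n + 1)/2 is the
    inverse of 2. *)
Lemma two_half : 2%:R * ((m.+3)./2)%:R = 1 :> Z.
Proof.
rewrite -natrM (_ : (2 * _)%N = m.+3); last by lia.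
by rewrite mulrSr ord_n_eq0 add0r.
Qed.

Lemma double_eq0 (x : Z) : x + x = 0 -> x = 0.
Proof.
move=> xx0; rewrite -[x]mul1r -two_half.
have -> : 2%:R * (m.+3)./2%:R * x = (m.+3)./2%:R * (x + x) by ring.
by rewrite xx0 mulr0.
Qed.

Lemma four_neq0 : 2%:R + 2%:R <> 0 :> Z.
Proof. by rewrite -natrD => /eqP; rewrite ord_natr_eq0 => /dvdn_leq; lia. Qed.

Lemma cycle_adjE (i j : Z) : adj (s := C) i j = (j == i + 1) || (j == i - 1).
Proof.
rewrite /= /cycle_adj.
have S (x : Z) : ordS x = x + 1.
  by apply: val_inj; rewrite /= [(1 %% _)%N]modn_small // addn1.
rewrite !S [_ == i - 1]eq_sym subr_eq.
by case: (i =P j) => //= <-; rewrite -subr_eq0 opprD addNKr oppr_eq0 oner_eq0.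
Qed.

Definition step2 (i j : Z) := (j == i + 2%:R) || (j == i - 2%:R).

Lemma nbh_cycle (i : Z) : nbh (i : C) = [set i + 1; i - 1].
Proof. by apply/setP=> j; rewrite !inE cycle_adjE. Qed.

Lemma add1_neq_sub1 (i : Z) : i + 1 != i - 1.
Proof.
apply/eqP=> /addrI e; move/eqP: (oner_eq0 Z); apply; apply: double_eq0.
by rewrite {1}e addNr.
Qed.

Lemma step2_neq (i j : Z) : step2 i j -> i != j.
Proof.
have two_neq0 : 2%:R != 0 :> Z.
  by rewrite ord_natr_eq0; apply/negP=> /dvdn_leq; lia.
case/orP=> /eqP ->; rewrite -[X in X != _]addr0 (inj_eq (addrI _)) eq_sym //.
by rewrite oppr_eq0.
Qed.

Lemma step2xx (i : Z) : step2 i i = false.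
Proof. by apply/negbTE/negP=> /step2_neq; rewrite eqxx. Qed.

Lemma card_common_nbh_cycle (i j : Z) :
  #|nbh (i : C) :&: nbh (j : C)| = (2 * (i == j) + step2 i j)%N.
Proof.
rewrite -sum1_card (eq_bigl _ _ (fun x => in_setI x _ _)) big_mkcondr /=.
rewrite !nbh_cycle big_setU1 ?inE ?add1_neq_sub1 //= big_set1 !inE.
rewrite (inj_eq (addIr 1)) (inj_eq (addIr (- 1))).
have -> : (i + 1 == j - 1) = (j == i + 2%:R).
  by rewrite eq_sym subr_eq -addrA.
have -> : (i - 1 == j + 1) = (j == i - 2%:R).
  by rewrite subr_eq -addrA eq_sym [RHS]eq_sym [RHS]subr_eq eq_sym.
case: eqP => [<-|_]; first by rewrite step2xx orbT.
rewrite /= orbF /step2.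
(* The two disjuncts of step2 exclude each other, since n does not divide 4. *)
case: (j =P i + _) => [->|_]; case: (_ =P i - _) => //.
by move/addrI => e; case: four_neq0; rewrite {1}e addNr.
Qed.

(** Here [a] counts the steps +1 and [l - a] the steps -1 of the walk. *)
Lemma walk_cycle l (i j : Z) :
  walk l (i : C) (j : C) -> exists2 a, (a <= l)%N & j + l%:R = i + (2 * a)%:R.
Proof.
elim: l i => [|l IH] i /=; first by move=> <-; exists 0%N; rewrite ?muln0.
case=> z; rewrite -[cycle_adj i z]/(adj (s := C) i z) cycle_adjE.
move=> /orP[] /eqP -> /IH[a al e].
  exists a.+1 => //; rewrite mulrSr addrA e mulnS natrD; ring.
exists a; first exact: leqW.
by rewrite mulrSr addrA e; ring.
Qed.

(** The length is m = n - 2, odd: with [a] steps +1 it would force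
    2(a + 1) = 0 modulo n, whereas 0 < a + 1 < n. *)
Lemma no_closed_walk (i : Z) : ~ walk m (i : C) (i : C).
Proof.
move=> /walk_cycle[a am] /addrI e.
have: (a.+1)%:R + (a.+1)%:R = 0 :> Z.
  transitivity ((m.+2)%:R : Z); last exact: ord_n_eq0.
  by rewrite 2![in RHS]mulrSr e mul2n -addnn natrD !mulrSr; ring.
by move/double_eq0/eqP; rewrite ord_natr_eq0 => /dvdn_leq; lia.
Qed.

Lemma walk_ascend l (i : Z) : walk l (i : C) (i + l%:R : C).
Proof.
elim: l i => [|l IH] i /=; first by rewrite addr0.
exists (i + 1).
  by rewrite -[cycle_adj _ _]/(adj (s := C) _ _) cycle_adjE eqxx.
by rewrite mulrS addrA.
Qed.

Lemma walk_around (i : Z) : walk m (i + 1 : C) (i - 1 : C).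
Proof.
rewrite (_ : i - 1 = i + 1 + m%:R); first exact: walk_ascend.
have e := ord_n_eq0; rewrite !mulrSr in e.
rewrite (_ : m%:R = - 2%:R :> Z); first by ring.
by apply: (addIr 2%:R); rewrite addNr -e; ring.
Qed.

Lemma deg_cycle (i : Z) : deg (i : C) = 2.
Proof. by rewrite /deg nbh_cycle cards2 add1_neq_sub1. Qed.

(** Translation by 2 acts transitively on Z/n. *)
Lemma translate_invariant T (f : Z -> T) :
  (forall i, f (i + 2%:R) = f i) -> forall i, f i = f 0.
Proof.
move=> f2 i.
have f2n (j : Z) l : f (j + 2%:R * l%:R) = f j.
  elim: l j => [|l IH] j; first by rewrite mulr0 addr0.
  by rewrite [l.+1%:R]mulrS mulrDr mulr1 addrA IH.
rewrite -[i]natr_Zp; elim: (i : nat) => // l IH.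
by rewrite mulrSr -[X in _ + X]two_half f2n.
Qed.

Lemma step2_sub (i j : Z) : step2 i j = (j - i == 2%:R) || (j - i == - 2%:R).
Proof. by rewrite /step2 !subr_eq ![_ + i]addrC. Qed.

(** The increments f (i + 2) - f i are +-2, and two consecutive ones cannot be
    opposite, or f (i + 4) = f i.  So they are constant, and dividing by 2 gives
    the increments f (i + 1) - f i. *)
Lemma step2_affine (f : Z -> Z) :
    injective f -> (forall i, step2 (f i) (f (i + 2%:R))) ->
  exists2 e, (e == 1) || (e == - 1) & forall i, f i = f 0 + e * i.
Proof.
move=> f_inj f_step; pose d i := f (i + 2%:R) - f i.
have d_cst i : d i = d 0.
  apply: (translate_invariant (f := d)) => {}i.
  have := f_step i; have := f_step (i + 2%:R).
  rewrite !step2_sub -/(d _) -/(d _).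
  have back : d (i + 2%:R) + d i != 0.
    rewrite /d addrA subrK subr_eq0 (inj_eq f_inj) -addrA -[X in _ != X]addr0.
    by rewrite (inj_eq (addrI _)); apply/eqP/four_neq0.
  by case/orP=> /eqP e2 /orP[] /eqP e1; rewrite ?e1 ?e2 //;
    move: back; rewrite e1 e2 ?addNr ?addrN eqxx.
exists (d 0 * (m.+3)./2%:R).
  have := f_step 0; rewrite step2_sub -/(d 0) => /orP[] /eqP ->.
    by rewrite two_half eqxx.
  by rewrite mulNr two_half eqxx orbT.
have f2 j : f (j + 2%:R) = f j + d 0 by rewrite -(d_cst j) [RHS]addrC subrK.
clearbody d; have fn l (i : Z) : f (i + 2%:R * l%:R) = f i + d 0 * l%:R.
  elim: l => [|l IH]; first by rewrite !mulr0 !addr0.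
  rewrite [l.+1%:R]mulrSr (mulrDr 2%:R) (mulrDr (d 0)) !mulr1.
  by rewrite (addrA i) f2 IH addrA.
move=> i; have := fn ((m.+3)./2 * i)%N 0.
by rewrite natrM natr_Zp !mulrA two_half mul1r add0r.
Qed.

Lemma affine_adj (a e i j : Z) : (e == 1) || (e == - 1) ->
  adj (s := C) (a + e * i) (a + e * j) = adj (s := C) i j.
Proof.
rewrite !cycle_adjE -!addrA !(inj_eq (addrI a)) => /orP[] /eqP->.
  by rewrite !mul1r.
by rewrite !mulN1r !eqr_oppLR !opprD !opprK orbC.
Qed.

(** Odd cycles of length at least 5 are R-thin: distinct vertices have at most
    one common neighbour. *)
Lemma cycle_nbh_inj (x y : Z) :
  adj (s := C) y (x + 1) -> adj (s := C) y (x - 1) -> x = y.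
Proof.
move=> yx1 yxN1; apply/eqP.
have: nbh (x : C) \subset nbh (x : C) :&: nbh (y : C).
  by rewrite subsetI subxx nbh_cycle subUset !sub1set !in_set yx1 yxN1.
move/subset_leq_card.
by rewrite card_common_nbh_cycle -/(deg (x : C)) deg_cycle; lia.
Qed.

(** * The product with an odd cycle *)

Section ProductWithCycle.

Variable G : sgraph.
Hypothesis G_thin : R_thin G.
Hypothesis deg_gt0 : forall u : G, (0 < deg u)%N.
Hypothesis star_dep : forall u v : G, star_adj u v ->
  ~~ independent (nbh u :&: nbh v).
Local Notation P := (direct_product G C).

Lemma deg_dprod_cycle (p : P) : deg p = (deg p.1 * 2)%N.
Proof.
by rewrite /deg nbh_dprod cardsX -/(deg p.1) -/(deg (p.2 : C)) deg_cycle.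
Qed.

Definition fibre_step (p q : P) := (p.1 == q.1) && step2 p.2 q.2.

(** If i and j share c neighbours, (u, i) and (v, j) are adjacent in P^* when
    deg u = deg v = c |N(u) :&: N(v)|.  For c = 2 this says that u, v are
    adjacent in G^*; for c = 1 it says N(u) = N(v), so u = v; c = 0 is excluded
    as degrees are positive. *)
Lemma star_adj_dprod_cycle (p q : P) :
  star_adj p q = fibre_step p q || star_adj p.1 q.1 && (p.2 == q.2).
Proof.
rewrite /star_adj !deg_dprod_cycle common_nbh_dprod cardsX.
rewrite card_common_nbh_cycle.
case: p q => [u i] [v j]; rewrite /fibre_step /=.
have -> : ((u, i) != (v, j) :> P) = (u != v) || (i != j) by rewrite -negb_and.
rewrite eqn_pmul2r //.
case: (i =P j) => [<-|/eqP ij].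
  rewrite step2xx !andbF !andbT orbF addn0 muln1 /=.
  by congr [&& _, _ & _]; lia.
rewrite muln0 add0n orbT andbF orbF /=.
case: (step2 i j) => /=; last by
  rewrite !muln0 andbF; have := deg_gt0 v; lia.
rewrite andbT muln1 mulnC eqn_pmul2l //.
apply/andP/eqP => [[/eqP du /eqP dv] | ->]; last by rewrite setIid !eqxx.
apply/eqP/negPn/negP => /G_thin/negP; apply.
have uI : nbh u :&: nbh v == nbh u by rewrite eqEcard subsetIl -dv -du /=.
have vI : nbh u :&: nbh v == nbh v by rewrite eqEcard subsetIr -dv /=.
by apply/eqP; rewrite -[LHS](eqP uI) (eqP vI).
Qed.

(** The right-hand side is phrased in terms of the graph P alone, hence is
    invariant under its automorphisms. *)
Lemma fibre_stepP (p q : P) :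
  fibre_step p q <-> star_adj p q /\
    (forall x y, x \in nbh p :&: nbh q -> y \in nbh p :&: nbh q ->
      ~ walk m x y).
Proof.
rewrite star_adj_dprod_cycle common_nbh_dprod; split=> [pq | [/orP[//|]]].
  rewrite pq; split=> // -[w a] [z b] /setXP[_ /= a_in] /setXP[_ /= b_in].
  case/walk_dprod=> /= _; case/andP: pq => _ pq.
  have /cards1P[c ec] : #|nbh (p.2 : C) :&: nbh (q.2 : C)| == 1%N.
    by rewrite card_common_nbh_cycle pq (negPf (step2_neq pq)).
  move: a_in b_in; rewrite ec !inE => /eqP-> /eqP->; exact: no_closed_walk.
case/andP=> /star_dep; rewrite negb_forall_in => /exists_inP[w w_in].
rewrite negb_forall_in => /exists_inP[z z_in]; rewrite negbK => wz /eqP <- noW.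
case: (noW (w, p.2 + 1) (z, p.2 - 1));
  rewrite ?in_setX ?w_in ?z_in ?setIid ?nbh_cycle ?inE ?eqxx ?orbT //=.
apply/walk_dprod; split; last exact: walk_around.
by have := walk_edge m wz; rewrite m_odd.
Qed.

Lemma fibre_step_aut (s : {perm P}) p q :
  s \in graph_aut P -> fibre_step (s p) (s q) = fibre_step p q.
Proof.
move=> hs; apply/idP/idP => /fibre_stepP[pq noW]; apply/fibre_stepP; split.
- by rewrite -(star_adj_aut hs).
- move=> x y x_in y_in /(walk_aut m x y hs); apply: noW;
  by rewrite mem_common_nbh_aut.
- by rewrite star_adj_aut.
move=> x y; rewrite -[x](permKV s) -[y](permKV s) !mem_common_nbh_aut //.
move=> x_in y_in.
by move/(walk_aut _ _ _ hs); apply: noW.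
Qed.

Hypothesis G_conn : connected G.

Lemma aut_factorization (u0 : G) (s : {perm P}) :
    s \in graph_aut P ->
  exists2 a, a \in setX (graph_aut G) (graph_aut C) & s = pair_perm a.
Proof.
move=> hs; have /graph_autP hadj := hs.
pose alpha u := (s (u, 0)).1; pose phi u i := (s (u, i)).2.
have s_step u i : fibre_step (s (u, i)) (s (u, i + 2%:R)).
  by rewrite fibre_step_aut // /fibre_step /= /step2 !eqxx.
have sE u i : s (u, i) = (alpha u, phi u i).
  rewrite [LHS]surjective_pairing; congr (_, _).
  apply: (translate_invariant (f := fun i => (s (u, i)).1)) => {}i.
  by have /andP[/eqP] := s_step u i.
have phi_inj u : injective (phi u).
  move=> i j e; have /perm_inj[] // : s (u, i) = s (u, j).
  by rewrite !sE e.
have phi_affine u :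
  exists2 e, (e == 1) || (e == - 1) & forall i, phi u i = phi u 0 + e * i.
  by apply: step2_affine => // i; have /andP[] := s_step u i.
have s_adj u i v j : adj (alpha u) (alpha v) && adj (s := C) (phi u i) (phi v j)
    = adj u v && adj (s := C) i j.
  by have := hadj (u, i) (v, j); rewrite !sE.
have phi_adj u v : adj u v -> phi v =1 phi u.
  move=> uv i; have [e e1 phi_v] := phi_affine v.
  have phi_nbr j : adj (s := C) i j -> adj (s := C) (phi u i) (phi v j).
    by move=> ij; have := s_adj u i v j; rewrite uv ij => /andP[].
  have up : adj (s := C) (phi u i) (phi v (i + 1)).
    by apply: phi_nbr; rewrite cycle_adjE eqxx.
  have dn : adj (s := C) (phi u i) (phi v (i - 1)).
    by apply: phi_nbr; rewrite cycle_adjE eqxx orbT.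
  rewrite (phi_v (i + 1)) (phi_v (i - 1)) !mulrDr mulrN mulr1 !addrA in up dn.
  rewrite -phi_v in up dn.
  (* For e = -1 the two neighbours phi_v i +- 1 are exchanged. *)
  by case/orP: e1 up dn => /eqP ->; rewrite ?opprK => up dn;
    apply: cycle_nbh_inj.
have phiE u : phi u =1 phi u0.
  have /connectP[l] := G_conn u0 u.
  elim/last_ind: l u => [|l v IH] w /=; first by move=> _ ->.
  rewrite rcons_path last_rcons => /andP[lp lv] -> i.
  by rewrite (phi_adj _ _ lv); apply: IH.
have alpha_inj : injective alpha.
  move=> u v e; have /perm_inj[] // : s (u, 0) = s (v, 0).
  by rewrite !sE e !phiE.
have phi_aut i j : adj (s := C) (phi u0 i) (phi u0 j) = adj (s := C) i j.
  by have [d d1 du] := phi_affine u0; rewrite (du i) (du j) affine_adj.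
have alpha_aut u v : adj (alpha u) (alpha v) = adj u v.
  have := s_adj u 0 v 1; rewrite !phiE phi_aut.
  by rewrite cycle_adjE add0r eqxx !andbT.
exists (perm alpha_inj, perm (phi_inj u0)).
  apply/setXP; split; apply/graph_autP=> x y; rewrite !permE.
    exact: alpha_aut.
  exact: phi_aut.
by apply/permP=> -[u i]; rewrite pair_permE sE !permE phiE.
Qed.

End ProductWithCycle.

End OddCycle.

Theorem theorem1p5 (G : sgraph) (k : nat) (hG : 1 < #|G|) (hthin : R_thin G)
    (hconn : connected G) (hk : 2 <= k)
    (hstar : forall u v : G, adj (s := star G) u v ->
               ~~ independent (nbh u :&: nbh v)) :
  stable G (cycle_graph (2 * k + 1)).
Proof.
have deg_gt0 (u : G) : 0 < deg u.
  have [v vu] : exists v, v != u.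
    apply/existsP; rewrite -[[exists _, _]]negbK negb_exists.
    apply/negP=> /forallP h; move: hG; rewrite (@eq_card1 _ u) // => v.
    by rewrite inE; apply/esym/negPn/h.
  have /connectP[[|w l] /= ul e] := hconn u v; first by rewrite e eqxx in vu.
  by apply/card_gt0P; exists w; case/andP: ul; rewrite inE.
have /card_gt0P[u0 _] : 0 < #|G| by apply: leq_trans hG.
have -> : 2 * k + 1 = (2 * k).-1.+2 by lia.
apply: (@stable_of_factorization _ (cycle_graph _) u0 ord0) => s.
by apply: aut_factorization => //; lia.
Qed.
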